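(* Fix $n$ and integers $a_0,a_1,\dots,a_h$ with $a_0=1$, $a_N\ge 1$ for $N=1,\dots,h$, and $a_0+a_1+\cdots+a_h=n$. Set $\mathcal{L}_0=\{1\}$ and $\mathcal{L}_N=[a_0+\cdots+a_{N-1}+1,\ a_0+\cdots+a_N]$ for $N=1,\dots,h$ (so $|\mathcal{L}_N|=a_N$). Then the number of graphs $G$ such that (1) $V(G)=[n]$, (2) $G$ is connected and the labeling $V(G)=[n]$ is closed, and (3) the $N$-th layer of $G$ is $\mathcal{L}_N$ for $N=0,\dots,h$, equals \[\prod_{N=0}^{h-1}\binom{a_{N+1}+a_N-1}{a_N-1}.\]
   Context: All graphs are finite and simple. For $i\le j$ in $[n]$, $[i,j]=\{k\in[n]: i\le k\le j\}$. A labeling $V(G)=[n]$ is closed if whenever $\{j,i\},\{i,k\}\in E(G)$ with $j\neq k$ and either $j>i<k$ or $j<i>k$, then $\{j,k\}\in E(G)$. For a connected graph with $V(G)=[n]$, the $N$-th layer is $L_N=\{i\in[n]: \text{the graph distance from } i \text{ to } 1 \text{ is } N\}$. *)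

(* Defs.v *)
From HB Require Import structures.
From mathcomp Require Import all_boot.

Set Implicit Arguments.
Unset Strict Implicit.
Unset Printing Implicit Defensive.

(** The vertex set [n] = {1, ..., n} is represented by 'I_n: the ordinal i
    stands for the vertex with label i.+1. *)
Record sgraph (n : nat) := SGraph {
  edges : {set {set 'I_n}};
  edges_card2 : [forall e in edges, #|e| == 2] }.

HB.instance Definition _ n := [isSub for @edges n].
HB.instance Definition _ n := [Countable of sgraph n by <:].
HB.instance Definition _ n := [Finite of sgraph n by <:].

Definition adj n (G : sgraph n) : rel 'I_n :=
  fun x y => [set x; y] \in edges G.

Definition connected n (G : sgraph n) : bool :=
  [forall x, forall y, connect (adj G) x y].

Definition closed_labeling n (G : sgraph n) : bool :=
  [forall i : 'I_n, forall j : 'I_n, forall k : 'I_n,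
    [&& adj G j i, adj G i k, j != k & (i < j) && (i < k) || (j < i) && (k < i)]
    ==> adj G j k].

Definition walk_of_length n (G : sgraph n) (x y : 'I_n) (N : nat) : bool :=
  [exists p : N.-tuple 'I_n, path (adj G) x p && (last x p == y)].

Definition at_distance n (G : sgraph n) (x y : 'I_n) (N : nat) : bool :=
  walk_of_length G x y N && [forall M : 'I_N, ~~ walk_of_length G x y M].

(** The existential picks out the vertex labelled 1. *)
Definition layer n (G : sgraph n) (N : nat) : {set 'I_n} :=
  [set i | [exists v : 'I_n, (v.+1 == 1) && at_distance G i v N]].

(** The interval [p, q] of labels. *)
Definition interval n (p q : nat) : {set 'I_n} := [set k : 'I_n | p <= k.+1 <= q].

Definition prescribed_layer n (a : nat -> nat) (N : nat) : {set 'I_n} :=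
  if N is 0 then [set k : 'I_n | k.+1 == 1]
  else interval n ((\sum_(k < N) a k) + 1) (\sum_(k < N.+1) a k).

(* Main.v *)
Require Import Defs.
From mathcomp Require Import all_boot zify.

Set Implicit Arguments.
Unset Strict Implicit.
Unset Printing Implicit Defensive.

(** In a connected graph with a closed labeling, peaks and valleys of a walk can
    be shortcut, so any two vertices are joined by a monotone walk.  Hence
    consecutive labels are adjacent, and the larger neighbours of x form an
    interval {x+1, ..., r x}; the graph is encoded by the function r, which can be
    any monotone function with x < r x for every x but the last vertex.  The
    layers are the gaps between successive iterates of r at the first vertex, so
    prescribing them means that r sends the last vertex of each layer to the last
    vertex of the next one.  On the remaining a_N - 1 vertices of layer N, r is an
    arbitrary weakly increasing sequence of values among the last vertex of layer
    N and the a_(N+1) vertices of layer N+1. *)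

(** * Monotone walks under a closed labeling *)

Lemma adjC n (G : sgraph n) : symmetric (adj G).
Proof. by move=> x y; rewrite /adj setUC. Qed.

Lemma adj_neq n (G : sgraph n) (x y : 'I_n) : adj G x y -> x != y.
Proof.
move=> xy; apply: contraTneq (forall_inP (edges_card2 G) _ xy) => ->.
by rewrite setUid cards1.
Qed.

Lemma closed_peak n (G : sgraph n) (x y z : 'I_n) :
  closed_labeling G -> adj G x z -> adj G y z -> x < z -> y < z -> x != y ->
  adj G x y.
Proof.
move=> /forallP/(_ z)/forallP/(_ x)/forallP/(_ y)/implyP clG xz yz ltxz ltyz neq.
by apply: clG; rewrite xz adjC yz neq ltxz ltyz orbT.
Qed.

Lemma closed_valley n (G : sgraph n) (x y z : 'I_n) :
  closed_labeling G -> adj G z x -> adj G z y -> z < x -> z < y -> x != y ->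
  adj G x y.
Proof.
move=> /forallP/(_ z)/forallP/(_ x)/forallP/(_ y)/implyP clG xz yz ltxz ltyz neq.
by apply: clG; rewrite adjC xz yz neq ltxz ltyz.
Qed.

Definition up_adj n (G : sgraph n) : rel 'I_n := fun x y => adj G x y && (x < y).

Lemma connect_up_leq n (G : sgraph n) (x y : 'I_n) :
  connect (up_adj G) x y -> x <= y.
Proof.
case/connectP=> p + ->; elim: p x => //= z p IHp x /andP[/andP[_ ltxz] /IHp].
exact/leq_trans/ltnW.
Qed.

(** Induction on the walk from its end. The vertex before [z] on it and [x] are smaller neighbours
    of [z], hence adjacent or equal. If [x] is the smaller one, the peak moves down to that vertex;
    otherwise the shortened walk can be made to end at [x]. *)
Lemma up_connect_peak n (G : sgraph n) (x y z : 'I_n) : closed_labeling G ->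
  up_adj G x z -> connect (up_adj G) y z ->
  connect (up_adj G) x y || connect (up_adj G) y x.
Proof.
move=> clG xz /connectP[p + def_z]; elim/last_ind: p z xz def_z => [|p w IHp] z.
  by move=> xz /= <- _; rewrite connect1.
rewrite last_rcons => xz <-{w}; rewrite rcons_path.
case/andP=> yp uz; move: (xz) (uz) => /andP[axz ltxz] /andP[auz ltuz].
case: (ltngtP x (last y p)) => [ltxu | ltux | eqxu].
- apply: IHp (erefl _) yp; rewrite /up_adj ltxu andbT.
  by apply: closed_peak axz auz ltxz ltuz _ => //; rewrite -val_eqE /= ltn_eqF.
- apply/orP; right; apply/connectP; exists (rcons p x); rewrite ?last_rcons //.
  rewrite rcons_path yp /up_adj ltux andbT /=.
  by apply: closed_peak auz axz ltuz ltxz _ => //; rewrite -val_eqE /= ltn_eqF.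
- apply/orP; right; apply/connectP; exists p => //; exact: val_inj.
Qed.

(** Mirror image of [up_connect_peak], with the walk peeled from its start [z]. *)
Lemma up_connect_valley n (G : sgraph n) (x y z : 'I_n) : closed_labeling G ->
  up_adj G z x -> connect (up_adj G) z y ->
  connect (up_adj G) x y || connect (up_adj G) y x.
Proof.
move=> clG zx /connectP[p + def_y]; elim: p z zx def_y => [|u p IHp] z /=.
  by move=> zx -> _; rewrite (connect1 zx) orbT.
move=> zx def_y /andP[zu up]; move: (zx) (zu) => /andP[azx ltzx] /andP[azu ltzu].
case: (ltngtP x u) => [ltxu | ltux | eqxu].
- apply/orP; left; apply/connectP; exists (u :: p) => //=.
  rewrite up /up_adj ltxu !andbT.
  by apply: closed_valley azx azu ltzx ltzu _ => //; rewrite -val_eqE /= ltn_eqF.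
- apply: IHp def_y up; rewrite /up_adj ltux andbT.
  by apply: closed_valley azu azx ltzu ltzx _ => //; rewrite -val_eqE /= ltn_eqF.
- apply/orP; left; apply/connectP; exists p; first by rewrite (val_inj eqxu).
  by rewrite (val_inj eqxu).
Qed.

(** Each edge prepended to a monotone walk either extends it or forms a peak or a valley with it,
    and these can be shortcut. *)
Lemma connect_monotone n (G : sgraph n) (x y : 'I_n) : closed_labeling G ->
  connect (adj G) x y -> connect (up_adj G) x y || connect (up_adj G) y x.
Proof.
move=> clG /connectP[p + def_y]; elim: p x def_y => [|z p IHp] x /=.
  by move=> ->; rewrite connect0.
move=> def_y /andP[xz] /(IHp _ def_y).
have: up_adj G x z || up_adj G z x.
  rewrite /up_adj xz adjC xz /=; have := adj_neq xz; rewrite -val_eqE /=; lia.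
case/orP=> xz' /orP[zy|yz].
- by rewrite (connect_trans (connect1 xz') zy).
- exact: up_connect_peak yz.
- exact: up_connect_valley zy.
- by rewrite (connect_trans yz (connect1 xz')) orbT.
Qed.

(** A monotone walk between consecutive labels has no room for an intermediate vertex. *)
Lemma adj_succ n (G : sgraph n) (x y : 'I_n) :
  connected G -> closed_labeling G -> y = x.+1 :> nat -> adj G x y.
Proof.
move=> /forallP/(_ x)/forallP/(_ y) cxy clG def_y.
case/orP: (connect_monotone clG cxy) => [|/connect_up_leq]; last by lia.
case/connectP=> -[|z p] /= => [_ eqxy|/andP[/andP[xz ltxz] zp] lasty].
  by move: def_y; rewrite eqxy; lia.
have zy: z <= y by apply: (@connect_up_leq _ G); apply/connectP; exists p.
by have -> : y = z by apply: val_inj => /=; lia.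
Qed.

Lemma adj_interval n (G : sgraph n) (x y z : 'I_n) :
  connected G -> closed_labeling G -> adj G x z -> x < y < z ->
  adj G x y && adj G y z.
Proof.
move=> cG clG xz /andP[ltxy ltyz].
have yz: adj G y z.
  (* Induction on [y - x]: both [y] and [z] are larger neighbours of the predecessor of [y]. *)
  have: exists k, y = x + k :> nat by exists (y - x); lia.
  case=> k; elim: k y ltyz {ltxy} => [|k IHk] y ltyz def_y.
    by have -> : y = x by apply: val_inj => /=; lia.
  have lty' : x + k < n by have := ltn_ord y; lia.
  have {IHk}y'z : adj G (Ordinal lty') z by apply: IHk => //=; lia.
  apply: closed_valley (adj_succ cG clG _) y'z _ _ _ => //=; try lia.
  by rewrite -val_eqE /= ltn_eqF.
rewrite yz (closed_peak clG xz yz) //; first by lia.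
by rewrite -val_eqE /= ltn_eqF.
Qed.

(** * The reach function of a graph *)

(** [G] is determined by [r], which sends a vertex to its largest neighbour,
    except for [r m = m]. *)
Definition reaches m (G : sgraph m.+1) (r : nat -> nat) : Prop :=
  [/\ forall x, x <= m -> x <= r x <= m,
      forall x, x < m -> x < r x,
      forall x y, x <= y <= m -> r x <= r y
    & forall x y : 'I_m.+1, x < y -> adj G x y = (y <= r x)].

(** The disjunct [y == inord x] forces [x <= reach G x] for [x <= m], so the last vertex is fixed.
    Working on [nat] lets the function be iterated. *)
Definition reach m (G : sgraph m.+1) (x : nat) : nat :=
  \max_(y : 'I_m.+1 | (y == inord x) || adj G (inord x) y) y.

Lemma reachP m (G : sgraph m.+1) :
  connected G -> closed_labeling G -> reaches G (reach G).
Proof.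
move=> cG clG.
have adjE (x y : 'I_m.+1) : x < y -> adj G x y = (y <= reach G x).
  move=> ltxy; apply/idP/idP => [xy | ].
    by apply: (bigmax_sup y) => //; rewrite inord_val xy orbT.
  rewrite /reach inord_val.
  have [|z] := eq_bigmax_cond (A := [pred z | (z == x) || adj G x z])
    (fun z : 'I_m.+1 => z : nat).
    by apply/card_gt0P; exists x; rewrite inE eqxx.
  rewrite inE => /orP[/eqP-> -> | xz ->]; first by lia.
  rewrite leq_eqVlt => /orP[/eqP/val_inj-> // | ltyz].
  have ltxyz : x < y < z by rewrite ltxy.
  by case/andP: (adj_interval cG clG xz ltxyz).
have reach_ge x : x <= m -> x <= reach G x.
  by move=> lexm; apply: (bigmax_sup (inord x)); rewrite ?eqxx ?inordK.
split=> // [x lexm|x ltxm|x y /andP[lexy leym]].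
- by rewrite reach_ge //; apply/bigmax_leqP => y _; rewrite -ltnS.
- have lt_ord : (inord x : 'I_m.+1) < (inord x.+1 : 'I_m.+1) by rewrite !inordK; lia.
  have := adjE _ _ lt_ord; rewrite !inordK => [<-||]; try lia.
  by apply: adj_succ; rewrite // !inordK; lia.
have lexm := leq_trans lexy leym.
apply/bigmax_leqP => z; have [lezy _ | ltyz] := leqP z y.
  exact: leq_trans lezy (reach_ge _ leym).
case/orP=> [/eqP def_z|xz]; first by move: ltyz; rewrite def_z inordK; lia.
apply: (bigmax_sup z) => //.
have [eqxy|ltxy] := eqVneq x y; first by rewrite -eqxy xz orbT.
(* A neighbour [z] of [x] beyond [y] is also a neighbour of [y]. *)
have ltxyz : (inord x : 'I_m.+1) < (inord y : 'I_m.+1) < z by rewrite !inordK; lia.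
by case/andP: (adj_interval cG clG xz ltxyz) => _ ->; rewrite orbT.
Qed.

(** For [x < m], [x] is adjacent to [r x], and [r'] bounds every larger neighbour of [x]. *)
Lemma reaches_le m (G : sgraph m.+1) r r' x :
  reaches G r -> reaches G r' -> x <= m -> r x <= r' x.
Proof.
move=> [r_bd r_gt _ adjE] [r_bd' _ _ adjE'] lexm; have /andP[_ lerm] := r_bd _ lexm.
have [gexm|ltxm] := leqP m x.
  by have := r_bd' _ lexm; lia.
have lt_ord : (inord x : 'I_m.+1) < (inord (r x) : 'I_m.+1).
  by rewrite !inordK // r_gt.
by have := adjE _ _ lt_ord; rewrite adjE' // !inordK // leqnn.
Qed.

Lemma reaches_unique m (G : sgraph m.+1) r r' x :
  reaches G r -> reaches G r' -> x <= m -> r x = r' x.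
Proof. by move=> Gr Gr' lexm; apply/eqP; rewrite eqn_leq !(reaches_le (G := G)). Qed.

Lemma reaches_closed m (G : sgraph m.+1) r : reaches G r -> closed_labeling G.
Proof.
case=> _ _ r_mono adjE; apply/forallP=> i; apply/forallP=> j; apply/forallP=> k.
apply/implyP=> /and4P[ji ik]; rewrite -val_eqE /= => neq dir.
wlog ltjk : j k ji ik neq dir / j < k.
  move=> IH; case: (ltngtP j k) => [ltjk|ltkj|eqjk].
  - exact: IH.
  - by rewrite adjC; apply: IH => //; rewrite 1?adjC // 1?eq_sym //; lia.
  - by rewrite eqjk eqxx in neq.
(* At a valley [k <= r i <= r j]; at a peak [k < i <= r j]. *)
rewrite adjE //; case/orP: dir => /andP[lt1 lt2].
  rewrite adjE // in ik; apply: leq_trans ik _; apply: r_mono.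
  by have := ltn_ord j; lia.
by rewrite adjE // in ji; lia.
Qed.

Lemma reaches_connected m (G : sgraph m.+1) r : reaches G r -> connected G.
Proof.
case=> _ r_gt _ adjE.
have c0 (x : 'I_m.+1) : connect (adj G) ord0 x.
  case: x => x; elim: x => [|x IHx] ltx.
    by rewrite (_ : Ordinal ltx = ord0) //; apply: val_inj.
  apply: connect_trans (IHx (ltnW ltx)) (connect1 _).
  by rewrite adjE //=; apply: r_gt.
apply/forallP=> x; apply/forallP=> y; apply: connect_trans (c0 y).
by rewrite (sym_connect_sym (@adjC _ G)).
Qed.

Lemma reaches_inj m (G H : sgraph m.+1) r r' :
  reaches G r -> reaches H r' -> (forall x, x <= m -> r x = r' x) -> G = H.
Proof.
move=> [_ _ _ adjG] [_ _ _ adjH] eqr.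
have adjGH x y : adj G x y = adj H x y.
  wlog lexy : x y / x <= y.
    by move=> IH; have [/IH//|/ltnW/IH] := leqP x y; rewrite adjC => ->; rewrite adjC.
  have [/val_inj->|neq] := eqVneq (x : nat) (y : nat).
    by apply/idP/idP => /adj_neq; rewrite eqxx.
  by rewrite adjG ?adjH ?eqr //; [rewrite -ltnS | lia..].
apply: val_inj; apply/setP=> e /=; apply/idP/idP => he.
  have /cards2P[x [y [_ def_e]]] := forall_inP (edges_card2 G) _ he.
  by move: he (adjGH x y); rewrite /adj -def_e => ->.
have /cards2P[x [y [_ def_e]]] := forall_inP (edges_card2 H) _ he.
by move: he (adjGH x y); rewrite /adj -def_e => -> ->.
Qed.

Definition reach_edges m (r : nat -> nat) : {set {set 'I_m.+1}} :=
  [set e : {set 'I_m.+1} |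
    [exists x : 'I_m.+1, exists y : 'I_m.+1, (x < y <= r x) && (e == [set x; y])]].

Lemma reach_edges_card2 m r : [forall e in reach_edges m r, #|e| == 2].
Proof.
apply/forall_inP=> e; rewrite inE => /existsP[x /existsP[y /andP[/andP[ltxy _] /eqP->]]].
by rewrite cards2 neq_ltn ltxy.
Qed.

Definition reach_sgraph m r : sgraph m.+1 := SGraph (reach_edges_card2 m r).

Lemma adj_reach_sgraph m r (x y : 'I_m.+1) :
  x < y -> adj (reach_sgraph m r) x y = (y <= r x).
Proof.
move=> ltxy; rewrite /adj /= inE.
apply/existsP/idP => [[x' /existsP[y' /andP[/andP[ltxy' le'] /eqP eqe]]]|leyr].
  have := set21 x y; have := set22 x y; rewrite eqe !inE.
  by case/orP=> /eqP ey /orP[] /eqP ex; move: ltxy; rewrite ex ey // ?ltnn; lia.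
by exists x; apply/existsP; exists y; rewrite ltxy leyr eqxx.
Qed.

(** * Layers as gaps between iterates of the reach function *)

Lemma walkP n (G : sgraph n) (x y : 'I_n) N :
  reflect (exists p, [/\ size p = N, path (adj G) x p & last x p = y])
          (walk_of_length G x y N).
Proof.
apply: (iffP existsP) => [[p /andP[xp /eqP lp]]|[p [szp xp lp]]].
  by exists p; rewrite size_tuple.
by exists (tcast szp (in_tuple p)); rewrite val_tcast xp lp eqxx.
Qed.

Lemma walk_cons n (G : sgraph n) (x y z : 'I_n) N :
  adj G x y -> walk_of_length G y z N -> walk_of_length G x z N.+1.
Proof.
move=> xy /walkP[p [szp yp lp]]; apply/walkP; exists (y :: p).
by rewrite /= szp xy.
Qed.

Lemma iter_reach_le m (G : sgraph m.+1) r N : reaches G r -> iter N r 0 <= m.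
Proof. by case=> r_bd _ _ _; elim: N => //= N /r_bd/andP[]. Qed.

Lemma iter_reach_mono m (G : sgraph m.+1) r M N :
  reaches G r -> M <= N -> iter M r 0 <= iter N r 0.
Proof.
move=> Gr; have [r_bd _ _ _] := Gr.
elim: N => [|N IHN]; first by rewrite leqn0 => /eqP->.
rewrite leq_eqVlt => /orP[/eqP-> //|/IHN leMN]; apply: leq_trans leMN _.
by have /andP[] := r_bd _ (iter_reach_le N Gr).
Qed.

(** One step away from a vertex [y] leads at most to [r y], and [r] is monotone. *)
Lemma walk_le_iter_reach m (G : sgraph m.+1) r (x : 'I_m.+1) N :
  reaches G r -> walk_of_length G x ord0 N -> x <= iter N r 0.
Proof.
move=> Gr; have [r_bd _ r_mono adjE] := Gr.
case/walkP=> p [szp + lp]; elim: p x N szp lp => [|y p IHp] x [|N] //=.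
  by move=> _ ->.
move=> [szp] lp /andP[xy yp]; have leyr := IHp _ _ szp lp yp.
have itm := iter_reach_le N Gr.
case: (ltngtP x y) => [ltxy|ltyx|eqxy].
- by have := r_bd _ itm; lia.
- rewrite adjC adjE // in xy; apply: leq_trans xy _; apply: r_mono; lia.
- by have := adj_neq xy; rewrite -val_eqE /= eqxy eqxx.
Qed.

(** Such an [x] is adjacent to [iter N r 0], which for [N > 0] is the top of the preceding gap. *)
Lemma iter_reach_walk m (G : sgraph m.+1) r (x : 'I_m.+1) N :
  reaches G r -> iter N r 0 < x <= iter N.+1 r 0 -> walk_of_length G x ord0 N.+1.
Proof.
move=> Gr; have [r_bd r_gt _ adjE] := Gr.
elim: N x => [|N IHN] x /andP[ltx lex].
  apply: (@walk_cons _ _ _ ord0); first by rewrite adjC adjE.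
  by apply/walkP; exists [::].
have ltym : iter N.+1 r 0 < m.+1 by have := ltn_ord x; lia.
apply: (@walk_cons _ _ _ (Ordinal ltym)); first by rewrite adjC adjE.
apply: IHN; rewrite /= leqnn andbT; apply: r_gt.
have := iter_reach_mono Gr (leqnSn N); have := ltn_ord x; lia.
Qed.

Lemma layer_iter_reach m (G : sgraph m.+1) r (x : 'I_m.+1) N : reaches G r ->
  (x \in layer G N.+1) = (iter N r 0 < x <= iter N.+1 r 0).
Proof.
move=> Gr; rewrite inE; apply/existsP/idP => [[v]|inN].
  case/andP; rewrite eqSS => /eqP v0; have {v v0}-> : v = ord0 by exact: val_inj.
  case/andP=> wx /forallP nwx; rewrite (walk_le_iter_reach Gr wx) andbT.
  rewrite ltnNge; apply/negP => lexN.
  (* If [x <= iter N r 0], the gap containing [x] yields a walk too short for distance [N.+1]. *)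
  have [M leMN wM] : exists2 M, M <= N & walk_of_length G x ord0 M.
    elim: {wx nwx}N lexN => [|N IHN] /= lexN.
      exists 0 => //; apply/walkP; exists [::]; split=> //=.
      by apply: val_inj => /=; lia.
    have [/IHN[M leMN wM]|gtN] := leqP x (iter N r 0); first by exists M => //; lia.
    by exists N.+1 => //; apply: iter_reach_walk Gr _; rewrite gtN.
  by have := nwx (Ordinal (leMN : M < N.+1)); rewrite wM.
exists ord0; rewrite eqxx /= /at_distance (iter_reach_walk Gr inN).
apply/forallP=> M; apply/negP=> /(walk_le_iter_reach Gr).
by have := iter_reach_mono Gr (ltn_ord M : M <= N); lia.
Qed.

Lemma layer0 m (G : sgraph m.+1) : layer G 0 = [set ord0].
Proof.
apply/setP=> x; rewrite !inE; apply/existsP/eqP => [[v]|->].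
  case/andP=> /eqP[v0] /andP[/walkP[p [/size0nil-> _ /= ->]] _].
  exact: val_inj.
exists ord0; rewrite eqxx /=; apply/andP; split; last by apply/forallP; case.
by apply/walkP; exists [::].
Qed.

(** * Prescribed layers as a condition on the reach function *)

(** The [N]-th prescribed layer is {first_of a N, ..., last_of a N} as a set of
    ordinals, which are numbered from 0. *)
Definition first_of (a : nat -> nat) N := \sum_(k < N) a k.
Definition last_of (a : nat -> nat) N := (\sum_(k < N.+1) a k).-1.

Definition composition (a : nat -> nat) (m h : nat) : Prop :=
  [/\ a 0 = 1, forall N, N <= h -> 1 <= a N & last_of a h = m].

Definition jumps (a : nat -> nat) (h : nat) (r : nat -> nat) : Prop :=
  forall N, N < h -> r (last_of a N) = last_of a N.+1.

Lemma last_of0 a : a 0 = 1 -> last_of a 0 = 0.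
Proof. by move=> a0; rewrite /last_of big_ord1 a0. Qed.

Lemma first_ofS a N : a 0 = 1 -> first_of a N.+1 = (last_of a N).+1.
Proof. by move=> a0; rewrite /first_of /last_of big_ord_recl a0. Qed.

Lemma last_ofS a N : a 0 = 1 -> last_of a N.+1 = last_of a N + a N.+1.
Proof. by move=> a0; rewrite /last_of big_ord_recr /= big_ord_recl a0. Qed.

Lemma first_of_last_of a N : 0 < a N -> last_of a N = first_of a N + (a N).-1.
Proof. by rewrite /last_of /first_of big_ord_recr /=; lia. Qed.

Lemma last_of_mono a M N : a 0 = 1 -> M <= N -> last_of a M <= last_of a N.
Proof.
move=> a0; elim: N => [|N IHN]; first by rewrite leqn0 => /eqP->.
rewrite leq_eqVlt => /orP[/eqP-> //|/IHN leMN].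
by rewrite last_ofS //; lia.
Qed.

Lemma block_of a h x : a 0 = 1 -> x <= last_of a h ->
  exists2 N, N <= h & first_of a N <= x <= last_of a N.
Proof.
move=> a0; elim: h => [|h IHh] lexh.
  by exists 0; rewrite // /first_of big_ord0.
have [/IHh[N leNh xN]|gtx] := leqP x (last_of a h); first by exists N => //; lia.
by exists h.+1; rewrite // lexh andbT first_ofS.
Qed.

(** By monotonicity [r x] lies between the values of [r] at the last vertices of blocks [N - 1] and
    [N]. The [minn] covers block [h], where only the bound [m] is available. *)
Lemma jumps_block a m h r N x : composition a m h -> jumps a h r ->
  (forall x y, x <= y <= m -> r x <= r y) -> (forall x, x <= m -> r x <= m) ->
  N <= h -> first_of a N <= x <= last_of a N ->
  last_of a N <= r x <= last_of a (minn N.+1 h).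
Proof.
move=> [a0 a_gt0 lastm] jr r_mono r_bd leNh /andP[fx xl].
have lexm : x <= m by rewrite -lastm; apply: leq_trans xl (last_of_mono a0 leNh).
apply/andP; split.
  case: N fx {xl} leNh => [|N] fx leNh; first by rewrite last_of0.
  by rewrite -jr //; apply: r_mono; rewrite lexm andbT ltnW // -first_ofS.
have [ltNh|geNh] := ltnP N h.
  rewrite (minn_idPl ltNh) -jr //; apply: r_mono.
  by rewrite xl -lastm last_of_mono.
by rewrite (minn_idPr (leqW geNh)) lastm; apply: r_bd.
Qed.

(** Inside block [N], [r x >= last_of a N > x]; at its last vertex the jump is strict because the
    next block is nonempty. *)
Lemma jumps_gt a m h r x : composition a m h -> jumps a h r ->
  (forall x y, x <= y <= m -> r x <= r y) -> (forall x, x <= m -> r x <= m) ->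
  x < m -> x < r x.
Proof.
move=> comp jr r_mono r_bd ltxm; have [a0 a_gt0 lastm] := comp.
have lexh : x <= last_of a h by rewrite lastm ltnW.
have [N leNh xN] := block_of a0 lexh.
have /andP[lerx _] := jumps_block comp jr r_mono r_bd leNh xN.
case/andP: xN => _; rewrite leq_eqVlt => /orP[/eqP eqx|ltx]; last by lia.
have ltNh : N < h.
  by rewrite ltn_neqAle leNh andbT; apply/eqP=> eqN; rewrite eqx eqN lastm ltnn in ltxm.
by rewrite eqx jr // last_ofS //; have := a_gt0 _ ltNh; lia.
Qed.

(** Both sides amount to [iter N r 0 = last_of a N] for all [N <= h]. *)
Lemma layers_jumps a m h (G : sgraph m.+1) r : composition a m h -> reaches G r ->
  reflect (jumps a h r)
    [forall N : 'I_h.+1, layer G N == prescribed_layer m.+1 a N].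
Proof.
move=> [a0 a_gt0 lastm] Gr.
have last_lem N : N <= h -> last_of a N <= m by rewrite -lastm; apply: last_of_mono.
have prescribedE N (x : 'I_m.+1) : (x \in prescribed_layer m.+1 a N.+1) =
    (last_of a N < x <= last_of a N.+1).
  rewrite /= inE -/(first_of a N.+1) -/(first_of a N.+2) !first_ofS //; lia.
apply: (iffP forallP) => [layersE | jr].
  have iterE N : N <= h -> iter N r 0 = last_of a N.
    elim: N => [|N IHN] ltNh; first by rewrite last_of0.
    have lastS := last_ofS N a0; have aN := a_gt0 _ ltNh; have lastNm := last_lem _ ltNh.
    have itm := iter_reach_le N.+1 Gr.
    (* The two intervals share their left end by induction; testing [y] at both right ends
       identifies these, the prescribed interval being nonempty. *)
    have mem y : y <= m ->
        (iter N r 0 < y <= iter N.+1 r 0) = (last_of a N < y <= last_of a N.+1).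
      move=> leym; have := layersE (Ordinal (ltNh : N.+1 < h.+1)).
      move=> /eqP/setP/(_ (inord y)) /=.
      by rewrite prescribedE (layer_iter_reach _ _ Gr) inordK.
    have eqN := IHN (ltnW ltNh); have := mem _ lastNm; have := mem _ itm; lia.
  by move=> N ltNh; rewrite -!iterE // ltnW.
have iterE N : N <= h -> iter N r 0 = last_of a N.
  by elim: N => [|N IHN] ltNh; [rewrite last_of0 | rewrite /= IHN ?jr // ltnW].
case=> [[|N] ltNh]; apply/eqP/setP=> x /=; first by rewrite layer0 !inE.
by rewrite prescribedE (layer_iter_reach _ _ Gr) !iterE // ltnW.
Qed.

Definition good m h a (G : sgraph m.+1) : bool :=
  [&& connected G, closed_labeling G &
      [forall N : 'I_h.+1, layer G N == prescribed_layer m.+1 a N]].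

Lemma good_reaches m h a (G : sgraph m.+1) r :
  composition a m h -> reaches G r -> jumps a h r -> good h a G.
Proof.
move=> comp Gr jr; rewrite /good (reaches_connected Gr) (reaches_closed Gr) /=.
exact/(layers_jumps comp Gr).
Qed.

(** * Encoding by families of sorted tuples *)

(** The default [ord_max] prolongs the tuple by its largest possible value, so monotonicity persists
    past the end. *)
Lemma nth_sorted_ord k p (t : k.-tuple 'I_p.+1) i j :
  sorted leq (map val t) -> i <= j -> nth ord_max t i <= nth ord_max t j.
Proof.
move=> st leij; have [ltjk|gejk] := ltnP j k; last first.
  by rewrite [nth _ _ j]nth_default ?size_tuple //= -ltnS.
have ltik := leq_ltn_trans leij ltjk.
rewrite sorted_map in st.
have leq_val_trans : transitive (relpre (val : 'I_p.+1 -> nat) leq).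
  by move=> y x z; apply: leq_trans.
have leq_val_refl : reflexive (relpre (val : 'I_p.+1 -> nat) leq) by move=> x /=.
by apply: (sorted_leq_nth leq_val_trans leq_val_refl); rewrite ?inE ?size_tuple.
Qed.

(* On block N < h, the function [r] takes values in last_of a N + [0, a N.+1] and
   is forced at the last vertex, so it amounts to a tuple of length (a N).-1. *)
Local Notation codes h a :=
  {dffun forall N : 'I_h, (a (nat_of_ord N)).-1.-tuple 'I_(a (nat_of_ord N).+1).+1}.

Definition code m h (a : nat -> nat) (G : sgraph m.+1) : codes h a :=
  [ffun N : 'I_h =>
    [tuple inord (reach G (first_of a N + j) - last_of a N) | j < (a N).-1]].

(* Reading past the end of [f N] gives [a N.+1], the value of the last vertex of
   block N; on later blocks this term is dominated by those of later indices. *)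
Definition decode h (a : nat -> nat) (f : codes h a) (x : nat) : nat :=
  \max_(N < h | first_of a N <= x) (last_of a N + nth ord_max (f N) (x - first_of a N)).

Definition sorted_codes h (a : nat -> nat) : {set codes h a} :=
  setXn (fun N : 'I_h =>
    [set t : (a N).-1.-tuple 'I_(a N.+1).+1 | sorted leq (map val t)]).

Lemma card_sorted_codes h a :
  (forall N, N <= h -> 1 <= a N) ->
  #|sorted_codes h a| = \prod_(N < h) 'C(a N.+1 + a N - 1, a N - 1).
Proof.
move=> a_gt0; rewrite cardsXn; apply: eq_bigr => N _.
(* Stars and bars: weakly increasing sequences of length [a N - 1] with [a N.+1 + 1] possible
   values. *)
rewrite card_sorted_tuples; have := a_gt0 _ (ltnW (ltn_ord N)) => aN.
by congr 'C(_, _); lia.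
Qed.

Lemma code_nth m h (a : nat -> nat) (G : sgraph m.+1) (N : 'I_h) j : j < (a N).-1 ->
  nth ord_max (code h a G N) j
    = inord (reach G (first_of a N + j) - last_of a N).
Proof. by move=> ltj; rewrite ffunE (nth_mktuple _ _ (Ordinal ltj)). Qed.

Lemma leq_decode_term h (a : nat -> nat) (f : codes h a) (N : 'I_h) i :
  a 0 = 1 -> last_of a N + nth ord_max (f N) i <= last_of a N.+1.
Proof. by move=> a0; rewrite last_ofS // leq_add2l -ltnS. Qed.

Lemma decode_le a m h f x : composition a m h -> @decode h a f x <= m.
Proof.
move=> [a0 _ lastm]; apply/bigmax_leqP=> N _; rewrite -lastm.
exact: leq_trans (leq_decode_term _ _ _ a0) (last_of_mono a0 (ltn_ord N)).
Qed.

Lemma decode_mono h a f x y :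
  f \in sorted_codes h a -> x <= y -> decode f x <= decode f y.
Proof.
move=> /setXnP sf lexy; apply/bigmax_leqP=> N leNx.
apply: (bigmax_sup N); first exact: leq_trans leNx lexy.
by rewrite leq_add2l; apply: nth_sorted_ord; [have := sf N; rewrite inE | lia].
Qed.

(** Terms of index [M < N] are at most [last_of a M.+1 <= last_of a N]; those with [M > N] are
    excluded by [x < first_of a M]. *)
Lemma decode_block h (a : nat -> nat) (f : codes h a) (N : 'I_h) x :
  a 0 = 1 -> first_of a N <= x <= last_of a N ->
  decode f x = last_of a N + nth ord_max (f N) (x - first_of a N).
Proof.
move=> a0 /andP[fx xl]; apply/eqP; rewrite eqn_leq andbC.
rewrite /decode (bigmax_sup N) //=; apply/bigmax_leqP=> M fMx.
have [ltMN|ltNM|/val_inj-> //] := ltngtP M N.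
  apply: leq_trans (leq_decode_term _ _ _ a0) _.
  exact: leq_trans (last_of_mono a0 ltMN) (leq_addr _ _).
have [M' def_M] : exists M', M = M'.+1 :> nat by exists M.-1; lia.
have fM : first_of a M = (last_of a M').+1 by rewrite def_M first_ofS.
by have := @last_of_mono a N M' a0; lia.
Qed.

Lemma decode_jumps a m h f : composition a m h -> jumps a h (@decode h a f).
Proof.
move=> [a0 a_gt0 _] N ltNh; have lastN := first_of_last_of (a_gt0 N (ltnW ltNh)).
rewrite (@decode_block _ _ _ (Ordinal ltNh)) //=; last by rewrite leqnn lastN leq_addr.
by rewrite nth_default ?size_tuple ?last_ofS //= lastN; lia.
Qed.

Lemma reaches_decode a m h f : composition a m h -> f \in sorted_codes h a ->
  reaches (reach_sgraph m (decode f)) (decode f).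
Proof.
move=> comp sf.
have d_le x : x <= m -> decode f x <= m by move=> _; apply: decode_le.
have d_mono x y : x <= y <= m -> decode f x <= decode f y.
  by case/andP=> lexy _; apply: decode_mono.
have d_gt x : x < m -> x < decode f x.
  exact: jumps_gt comp (decode_jumps f comp) d_mono d_le.
split=> // [x lexm|x y ltxy]; last exact: adj_reach_sgraph.
rewrite d_le // andbT; move: lexm; rewrite leq_eqVlt => /orP[/eqP->|/d_gt/ltnW//].
(* At [x = m]: either [m = 0], or [m] is already the value at the last vertex of the layer before
   the final one. *)
have [a0 _ lastm] := comp; case: h f sf comp lastm {d_le d_mono d_gt} => [|h] f sf comp lastm.
  by rewrite -lastm last_of0.
rewrite -{1}lastm -(decode_jumps f comp (ltnSn h)).
by apply: decode_mono => //; rewrite -lastm last_of_mono.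
Qed.

(** * The bijection and the count *)

Lemma code_inj a m h : composition a m h ->
  {in [set G : sgraph m.+1 | good h a G] &, injective (@code m h a)}.
Proof.
move=> comp G H; rewrite !inE => gG gH eqc; have [a0 a_gt0 lastm] := comp.
have [cG clG lG] := and3P gG; have [cH clH lH] := and3P gH.
have rG := reachP cG clG; have rH := reachP cH clH.
have jG := layers_jumps comp rG lG; have jH := layers_jumps comp rH lH.
apply: (reaches_inj rG rH) => x lexm.
have lexh : x <= last_of a h by rewrite lastm.
have [N leNh xN] := block_of a0 lexh.
have block (K : sgraph m.+1) : reaches K (reach K) -> jumps a h (reach K) ->
    last_of a N <= reach K x <= last_of a (minn N.+1 h).
  move=> [r_bd _ r_mono _] jK; apply: (jumps_block comp jK r_mono) => // y leym.
  by case/andP: (r_bd y leym).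
have := block _ rH jH; have {block} := block _ rG jG.
(* In block [h] the two bounds coincide, so both reach functions equal [m] there. *)
have [ltNh|geNh] := ltnP N h; last first.
  by rewrite (minn_idPr (leqW geNh)) (_ : N = h); lia.
rewrite (minn_idPl ltNh) last_ofS // => bG bH.
have [eqx|neqx] := eqVneq x (last_of a N); first by rewrite eqx jG ?jH.
have lastN := first_of_last_of (a_gt0 N leNh).
have ltj : x - first_of a (Ordinal ltNh) < (a (Ordinal ltNh)).-1 by rewrite /=; lia.
have := code_nth G ltj; rewrite eqc code_nth //= => /(congr1 val) /=.
(* By [bG] and [bH] both differences are at most [a N.+1], so [inord] loses nothing. *)
by rewrite subnKC; [rewrite !inordK; lia | lia].
Qed.

Lemma code_sorted a m h (G : sgraph m.+1) :
  composition a m h -> good h a G -> code h a G \in sorted_codes h a.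
Proof.
move=> comp /and3P[cG clG lG]; have rG := reachP cG clG; have [a0 a_gt0 lastm] := comp.
have jG := layers_jumps comp rG lG; have [r_bd _ r_mono _] := rG.
apply/setXnP=> N; rewrite inE sorted_map.
apply/(sortedP ord_max)=> i; rewrite size_tuple => ltj /=.
have lastN := first_of_last_of (a_gt0 N (ltnW (ltn_ord N))).
have lastm' : last_of a N <= m by rewrite -lastm last_of_mono // ltnW.
rewrite !code_nth //; last by lia.
have bd j : j < (a N).-1 -> reach G (first_of a N + j) - last_of a N < (a N.+1).+1.
  move=> ltj'; have /(jumps_block comp jG r_mono _ (ltnW (ltn_ord N))) :
    first_of a N <= first_of a N + j <= last_of a N by lia.
  rewrite (minn_idPl (ltn_ord N)) last_ofS // => bdN.
  have /bdN : forall x, x <= m -> reach G x <= m by move=> x /r_bd/andP[].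
  lia.
rewrite !inordK ?bd //; [|lia].
by apply: leq_sub2r; apply: r_mono; lia.
Qed.

(** The graph built from [decode f] has [decode f] as its reach function by uniqueness, and
    [decode_block] reads [f] back. *)
Lemma code_surj a m h f : composition a m h -> f \in sorted_codes h a ->
  exists2 G : sgraph m.+1, good h a G & f = code h a G.
Proof.
move=> comp sf; have [a0 a_gt0 lastm] := comp; have rG := reaches_decode comp sf.
set G := reach_sgraph m (decode f) in rG *.
have gG : good h a G by apply: (good_reaches comp rG); apply: decode_jumps.
exists G => //; have [cG clG _] := and3P gG.
apply/ffunP=> N; apply: eq_from_tnth => j; rewrite !(tnth_nth ord_max) code_nth //.
have lastN := first_of_last_of (a_gt0 N (ltnW (ltn_ord N))).
have lastm' : last_of a N <= m by rewrite -lastm last_of_mono // ltnW.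
have ltj := ltn_ord j.
rewrite (reaches_unique (reachP cG clG) rG); last by lia.
by rewrite (@decode_block _ _ _ N) //; [rewrite !addKn inord_val | lia].
Qed.

Theorem theorem5p4 (n h : nat) (a : nat -> nat)
    (a0 : a 0 = 1)
    (a_ge1 : forall N, 1 <= N <= h -> 1 <= a N)
    (sum_a : \sum_(N < h.+1) a N = n) :
  #|[set G : sgraph n |
      [&& connected G, closed_labeling G &
          [forall N : 'I_h.+1, layer G N == prescribed_layer n a N]]]|
  = \prod_(N < h) 'C(a N.+1 + a N - 1, a N - 1).
Proof.
have a_gt0 N : N <= h -> 1 <= a N by case: N => [|N] leNh; [rewrite a0 | apply: a_ge1].
case: n sum_a => [|m] sum_a; first by rewrite big_ord_recl a0 in sum_a.
have comp : composition a m h by split; rewrite // /last_of sum_a.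
rewrite -(card_sorted_codes a_gt0) -[LHS]/(#|[set G : sgraph m.+1 | good h a G]|).
(* It remains to see that the image of [code] is exactly the set of sorted codes. *)
rewrite -(card_in_imset (code_inj comp)); apply: eq_card => f.
apply/imsetP/idP => [[G]|/(code_surj comp)[G gG ->]].
  by rewrite inE => gG ->; apply: code_sorted.
by exists G; rewrite ?inE.
Qed.
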